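(* Let $\Phi$ be of type $A_n$ and $W=W(A_n)$. Let $\mathsf{s}_1,\mathsf{s}_2$ be sections of $1\to\mathbb{Z}\Phi\to\mathbb{Z}\Phi\rtimes W\xrightarrow{\pi}W\to1$, with $\mathsf{s}_1(s_i)=\tau_{a_i\alpha_i}s_i$ and $\mathsf{s}_2(s_i)=\tau_{b_i\alpha_i}s_i$, $a_i,b_i\in\mathbb{Z}$, and put $d_i=a_i-b_i$ for $i=1,\dots,n$. Then $\mathsf{s}_1$ and $\mathsf{s}_2$ define two different elements in $H^1(W,\mathbb{Z}\Phi)$ if and only if $$\overline{d_1}+2\overline{d_2}+\cdots+n\overline{d_n}\neq0\quad\text{in }\mathbb{Z}/(n+1)\mathbb{Z}.$$
   Context: $\Phi$ is the root system of type $A_n$ in a Euclidean space $V$ spanned by it, with simple roots $\alpha_1,\dots,\alpha_n$ numbered in order along the Dynkin diagram; $W$ is its Weyl group, generated by the simple reflections $s_i=s_{\alpha_i}$. $\mathbb{Z}\Phi$ is the root lattice, with $x\in\mathbb{Z}\Phi$ written as the translation $\tau_x$ in $\mathbb{Z}\Phi\rtimes W$. A section is a group morphism $\mathsf{s}:W\to\mathbb{Z}\Phi\rtimes W$ with $\pi\circ\mathsf{s}=\mathrm{id}_W$; every section is of the form $s_i\mapsto\tau_{k_i\alpha_i}s_i$ for a unique $(k_1,\dots,k_n)\in\mathbb{Z}^n$, and every such tuple occurs. $H^1(W,\mathbb{Z}\Phi)$ is identified with the set of sections up to conjugation by elements of $\mathbb{Z}\Phi$ (a section $\mathsf{s}(g)=\tau_{f(g)}g$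 corresponds to the class of the 1-cocycle $f$), so two sections define the same element iff there is $z\in\mathbb{Z}\Phi$ with $\mathsf{s}_2(g)=\tau_z\mathsf{s}_1(g)\tau_{-z}$ for all $g\in W$. The bar denotes the class modulo $n+1$. *)

(* Defs.v *)
From HB Require Import structures.
From mathcomp Require Export all_boot all_order all_algebra.
From mathcomp Require Import boolp.
From mathcomp Require Export reals.

Set Implicit Arguments.
Unset Strict Implicit.
Unset Printing Implicit Defensive.

Import Order.TTheory GRing.Theory Num.Theory.
Local Open Scope ring_scope.
Local Open Scope quotient_scope.

Section RootSystems.

Variables (R : realType) (V : vectType R) (form : {dot V for idfun}).

(* The pairing < x, a^vee > = 2 (x, a) / (a, a). *)
Definition cartan (x a : V) : R := 2 * form x a / form a a.

Definition refl_fun (a x : V) : V := x - cartan x a *: a.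

Lemma refl_is_linear a : linear (refl_fun a).
Proof.
move=> c x y; rewrite /refl_fun /cartan linearPl /=.
rewrite mulrDr mulrDl scalerDl opprD addrACA scalerBr scalerA.
by rewrite (mulrCA 2) !mulrA.
Qed.

HB.instance Definition _ a :=
  GRing.isLinear.Build R V V _ (refl_fun a) (refl_is_linear a).

Definition reflection (a : V) : 'End(V) := linfun (refl_fun a).

Lemma reflectionE a x : reflection a x = x - cartan x a *: a.
Proof. by rewrite lfunE. Qed.

Lemma cartanaa a : a != 0 -> cartan a a = 2.
Proof. by move=> a0; rewrite /cartan mulfK ?lt0r_neq0 ?neq0_dnorm_gt0. Qed.

Lemma cartan_diff a x c : cartan (x - c *: a) a = cartan x a - c * cartan a a.
Proof.
rewrite /cartan linearBl linearZl_LR /= mulrBr mulrBl.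
by rewrite (mulrCA 2) !mulrA.
Qed.

Lemma reflectionK a : a != 0 -> involutive (reflection a).
Proof.
move=> a0 x; rewrite 2!reflectionE cartan_diff cartanaa //.
by rewrite (mulr_natr _ 2) mulr2n opprD addrA subrr add0r scaleNr opprK subrK.
Qed.

(* Reduced crystallographic root systems; the finite set of roots is given by
   an enumeration, whose order and repetitions are irrelevant. *)
Record root_system := RootSystem {
  roots : seq V;
  roots_neq0 : 0 \notin roots;
  roots_span : <<roots>>%VS = fullv;
  roots_refl : forall a b, a \in roots -> b \in roots ->
    reflection a b \in roots;
  roots_int : forall a b, a \in roots -> b \in roots ->
    cartan b a \is a Num.int;
  roots_reduced : forall a (c : R), a \in roots -> c *: a \in roots ->
    c = 1 \/ c = -1 }.

Definition root (Phi : root_system) : Type := seq_sub (roots Phi).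

HB.instance Definition _ (Phi : root_system) := Finite.on (root Phi).
HB.instance Definition _ (Phi : root_system) := SubType.on (root Phi).

End RootSystems.

Section WeylGroup.

Variables (R : realType) (V : vectType R) (form : {dot V for idfun}).
Variable Phi : root_system form.

Lemma root_neq0 (r : root Phi) : val r != 0.
Proof. by apply: contraNneq (roots_neq0 Phi) => <-; apply: ssvalP. Qed.

(* Reflections are involutions, so the products of reflections in roots form
   the whole subgroup of GL(V) generated by these reflections. *)
Definition refl_prod (l : seq (root Phi)) : 'End(V) :=
  foldr (fun r w => (reflection form (val r) \o w)%VF) \1%VF l.

Definition in_weyl : {pred 'End(V)} :=
  fun w => `[< exists l : seq (root Phi), w = refl_prod l >].

Record weyl : Type :=
  Weyl { weyl_fun : 'End(V); weyl_funP : weyl_fun \in in_weyl }.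

HB.instance Definition _ := [isSub for weyl_fun].
HB.instance Definition _ := [Choice of weyl by <:].

Lemma refl_prod_cat l1 l2 :
  refl_prod (l1 ++ l2) = (refl_prod l1 \o refl_prod l2)%VF.
Proof.
by elim: l1 => [|r l1 IH] /=; rewrite ?comp_lfun1l // IH comp_lfunA.
Qed.

Lemma refl_prod_rev l : (refl_prod (rev l) \o refl_prod l = \1)%VF.
Proof.
elim: l => [|r l IH] /=; first by rewrite comp_lfun1l.
rewrite rev_cons -cats1 refl_prod_cat /= comp_lfun1r -comp_lfunA.
rewrite [X in (_ \o X)%VF]comp_lfunA.
suff -> : (reflection form (val r) \o reflection form (val r) = \1)%VF.
  by rewrite comp_lfun1l.
by apply/lfunP => x; rewrite comp_lfunE id_lfunE reflectionK ?root_neq0.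
Qed.

Lemma weyl_invP w : w \in in_weyl -> (w^-1)%VF \in in_weyl /\
  ((w^-1 \o w)%VF = \1%VF /\ (w \o w^-1)%VF = \1%VF).
Proof.
case/asboolP => l ->.
have lK := refl_prod_rev l; have := refl_prod_rev (rev l); rewrite revK => Kl.
have E : (refl_prod l)^-1%VF = refl_prod (rev l).
  have k0 : lker (refl_prod l) == 0%VS.
    apply/lker0P => x y exy.
    by rewrite -[x]id_lfunE -[y]id_lfunE -lK !comp_lfunE exy.
  rewrite -[LHS]comp_lfun1r -Kl comp_lfunA lker0_compVf //.
  by rewrite comp_lfun1l.
by rewrite E; split=> //; apply/asboolP; exists (rev l).
Qed.

Fact weyl_one_subproof : \1%VF \in in_weyl.
Proof. by apply/asboolP; exists [::]. Qed.

Fact weyl_mul_subproof (g h : weyl) :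
  (weyl_fun g \o weyl_fun h)%VF \in in_weyl.
Proof.
case/asboolP: (weyl_funP g) => l1 ->; case/asboolP: (weyl_funP h) => l2 ->.
by apply/asboolP; exists (l1 ++ l2); rewrite refl_prod_cat.
Qed.

Definition weyl_one : weyl := Weyl weyl_one_subproof.
Definition weyl_mul (g h : weyl) : weyl := Weyl (weyl_mul_subproof g h).
Definition weyl_inv (g : weyl) : weyl := Weyl (weyl_invP (weyl_funP g)).1.

Fact weyl_mulA : associative weyl_mul.
Proof. by move=> x y z; apply: val_inj; apply: comp_lfunA. Qed.
Fact weyl_mul1g : left_id weyl_one weyl_mul.
Proof. by move=> x; apply: val_inj; apply: comp_lfun1l. Qed.
Fact weyl_mulg1 : right_id weyl_one weyl_mul.
Proof. by move=> x; apply: val_inj; apply: comp_lfun1r. Qed.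
Fact weyl_mulVg : left_inverse weyl_one weyl_inv weyl_mul.
Proof. by move=> x; apply: val_inj; have [_ []] := weyl_invP (weyl_funP x). Qed.
Fact weyl_mulgV : right_inverse weyl_one weyl_inv weyl_mul.
Proof. by move=> x; apply: val_inj; have [_ []] := weyl_invP (weyl_funP x). Qed.

HB.instance Definition _ := isGroup.Build weyl
  weyl_mulA weyl_mul1g weyl_mulg1 weyl_mulVg weyl_mulgV.

Fact weyl_refl_subproof (r : root Phi) :
  reflection form (val r) \in in_weyl.
Proof. by apply/asboolP; exists [:: r]; rewrite /= comp_lfun1r. Qed.

Definition weyl_refl (r : root Phi) : weyl := Weyl (weyl_refl_subproof r).

Definition in_lattice : {pred V} :=
  fun x => `[< exists c : root Phi -> int, x = \sum_r val r *~ c r >].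

Fact in_lattice_zmod_closed : zmod_closed in_lattice.
Proof.
split; first by apply/asboolP; exists (fun=> 0); rewrite big1.
move=> _ _ /asboolP[c ->] /asboolP[d ->]; apply/asboolP.
exists (fun r => c r - d r); rewrite -sumrB.
by apply: eq_bigr => r _; rewrite mulrzBr.
Qed.

HB.instance Definition _ :=
  GRing.isZmodClosed.Build V in_lattice in_lattice_zmod_closed.

Record root_lattice : Type :=
  RootLattice { lattice_val : V; lattice_valP : lattice_val \in in_lattice }.

HB.instance Definition _ := [isSub for lattice_val].
HB.instance Definition _ := [Choice of root_lattice by <:].
HB.instance Definition _ := [SubChoice_isSubZmodule of root_lattice by <:].

Lemma root_in_lattice (r : root Phi) : val r \in in_lattice.
Proof.
apply/asboolP; exists (fun s => (s == r)%:Z); rewrite (bigD1 r) //= eqxx.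
by rewrite big1 ?addr0 // => s /negPf ->.
Qed.

Definition lattice_root (r : root Phi) : root_lattice :=
  RootLattice (root_in_lattice r).

Fact weyl_act_subproof (g : weyl) (x : root_lattice) :
  weyl_fun g (lattice_val x) \in in_lattice.
Proof.
case/asboolP: (weyl_funP g) => l ->; have xL := lattice_valP x.
elim: l => [|r l IH] /=; first by rewrite id_lfunE.
rewrite comp_lfunE; case/asboolP: IH => c ->.
rewrite linear_sum; apply: rpred_sum => s _; rewrite raddfMz rpredMz //.
have sP : reflection form (val r) (val s) \in roots Phi.
  by apply: roots_refl; apply: ssvalP.
exact: (root_in_lattice (SeqSub sP)).
Qed.

Definition weyl_act (g : weyl) (x : root_lattice) : root_lattice :=
  RootLattice (weyl_act_subproof g x).

Lemma weyl_actM g h x : weyl_act (g * h)%g x = weyl_act g (weyl_act h x).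
Proof. by apply: val_inj; rewrite /= comp_lfunE. Qed.

Lemma weyl_act1 x : weyl_act 1%g x = x.
Proof. by apply: val_inj; rewrite /= id_lfunE. Qed.

Lemma weyl_actD g x y : weyl_act g (x + y) = weyl_act g x + weyl_act g y.
Proof. by apply: val_inj; rewrite /= linearD. Qed.

Lemma weyl_act0 g : weyl_act g 0 = 0.
Proof. by apply: val_inj; rewrite /= linear0. Qed.

(* The pair (x, g) is the affine map v |-> g v + x. *)
Definition semidirect : Type := (root_lattice * weyl)%type.

HB.instance Definition _ := Choice.on semidirect.

Definition sd_one : semidirect := (0, 1%g).
Definition sd_mul (p q : semidirect) : semidirect :=
  (p.1 + weyl_act p.2 q.1, (p.2 * q.2)%g).
Definition sd_inv (p : semidirect) : semidirect :=
  (weyl_act p.2^-1%g (- p.1), p.2^-1%g).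

Fact sd_mulA : associative sd_mul.
Proof.
move=> [x g] [y h] [z k]; rewrite /sd_mul /=.
by rewrite weyl_actD weyl_actM addrA mulgA.
Qed.
Fact sd_mul1g : left_id sd_one sd_mul.
Proof. by case=> x g; rewrite /sd_mul /= weyl_act1 add0r mul1g. Qed.
Fact sd_mulg1 : right_id sd_one sd_mul.
Proof. by case=> x g; rewrite /sd_mul /= weyl_act0 addr0 mulg1. Qed.
Fact sd_mulVg : left_inverse sd_one sd_inv sd_mul.
Proof.
by case=> x g; rewrite /sd_mul /= -weyl_actD addNr weyl_act0 mulVg.
Qed.
Fact sd_mulgV : right_inverse sd_one sd_inv sd_mul.
Proof.
by case=> x g; rewrite /sd_mul /= -weyl_actM mulgV weyl_act1 subrr.
Qed.

HB.instance Definition _ := isGroup.Build semidirect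
  sd_mulA sd_mul1g sd_mulg1 sd_mulVg sd_mulgV.

Definition translation (x : root_lattice) : semidirect := (x, 1%g).
Definition sd_weyl (g : weyl) : semidirect := (0, g).
Definition sd_proj (p : semidirect) : weyl := p.2.

Record section := Section {
  section_fun :> {multiplicative weyl -> semidirect};
  section_proj : forall g, sd_proj (section_fun g) = g }.

HB.instance Definition _ := gen_eqMixin section.
HB.instance Definition _ := gen_choiceMixin section.

Definition cohomologous (s1 s2 : section) : bool :=
  `[< exists z : root_lattice, forall g : weyl,
        s2 g = (translation z * s1 g * translation (- z))%g >].

Lemma translationD x y :
  translation (x + y) = (translation x * translation y)%g.
Proof. by congr pair; rewrite /= ?weyl_act1 // mulg1. Qed.

Lemma translation0 : translation 0 = 1%g. Proof. by []. Qed.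

Fact cohomologous_refl : reflexive cohomologous.
Proof.
move=> s; apply/asboolP; exists 0 => g.
by rewrite oppr0 translation0 mul1g mulg1.
Qed.

Fact cohomologous_sym : symmetric cohomologous.
Proof.
suff H s1 s2 : cohomologous s1 s2 -> cohomologous s2 s1.
  by move=> s1 s2; apply/idP/idP; apply: H.
case/asboolP => z E; apply/asboolP; exists (- z) => g; rewrite E opprK.
rewrite !mulgA -translationD addNr.
by rewrite -!mulgA -translationD addNr translation0 mul1g mulg1.
Qed.

Fact cohomologous_trans : transitive cohomologous.
Proof.
move=> s2 s1 s3 /asboolP[z E] /asboolP[t F]; apply/asboolP.
exists (t + z) => g.
by rewrite F E opprD (addrC (- t)) !translationD !mulgA.
Qed.

Canonical cohomologous_equiv :=
  EquivRel cohomologous cohomologous_refl cohomologous_sym cohomologous_trans.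

Definition H1 := {eq_quot cohomologous}.

HB.instance Definition _ := EqQuotient.on H1.

Definition H1_class (s : section) : H1 := \pi_H1 s.

(* alpha is a base of Phi, numbered by 'I_n. *)
Definition simple_roots n (alpha : 'I_n -> root Phi) : Prop :=
  basis_of fullv [seq val (alpha i) | i <- enum 'I_n] /\
  forall r : root Phi, exists c : 'I_n -> nat,
    val r = \sum_i val (alpha i) *+ c i \/
    val r = - \sum_i val (alpha i) *+ c i.

Definition type_A n (alpha : 'I_n -> root Phi) : Prop :=
  forall i j : 'I_n, cartan form (val (alpha i)) (val (alpha j)) =
    if i == j then 2
    else if (i.+1 == j :> nat) || (j.+1 == i :> nat) then -1 else 0.

End WeylGroup.

(* Main.v *)
Require Import Defs.
From mathcomp Require Import boolp ring zify.
Import Order.TTheory GRing.Theory Num.Theory.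
Local Open Scope ring_scope.

(* Two sections are cohomologous iff conjugation by some z in the root lattice
   matches them on the simple reflections, i.e. iff the integral linear system
   <z, alpha_i^vee> = - d_i has a solution z = \sum_j z_j alpha_j.  In type A_n
   this reads - z_{i-1} + 2 z_i - z_{i+1} = - d_i with z_0 = z_{n+1} = 0: the
   solutions with z_0 = 0 form a one-parameter family, and summing the equations
   with weights i shows that z_{n+1} can be made 0 iff n + 1 divides
   \sum_i i d_i. *)

(** * Invariance of the form and conjugation of reflections *)

Section Reflections.

Variables (R : realType) (V : vectType R) (form : {dot V for idfun}).
Implicit Types x y a b : V.

Lemma dotC x y : form x y = form y x.
Proof. by rewrite (hermC form) expr0 mul1r. Qed.

Lemma cartanDl x y a : cartan form (x + y) a = cartan form x a + cartan form y a.
Proof. by rewrite /cartan linearDl mulrDr mulrDl. Qed.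

Lemma cartan0l a : cartan form 0 a = 0.
Proof. by rewrite /cartan linear0l mulr0 mul0r. Qed.

Lemma cartanZl (c : R) x a : cartan form (c *: x) a = c * cartan form x a.
Proof. by rewrite /cartan linearZl_LR /= mulrCA -!mulrA. Qed.

Lemma cartan_suml n (x : 'I_n -> V) a :
  cartan form (\sum_i x i) a = \sum_i cartan form (x i) a.
Proof.
exact: (big_morph (fun y => cartan form y a)
  (fun u v => cartanDl u v a) (cartan0l a)).
Qed.

Lemma dot_reflection a x y : a != 0 ->
  form (reflection form a x) (reflection form a y) = form x y.
Proof.
move=> a0; have aa0 : form a a != 0 by rewrite lt0r_neq0 ?neq0_dnorm_gt0.
rewrite !reflectionE linearBl !linearBr !linearZl_LR !linearZr_LR /= /cartan.
rewrite (dotC a y); field.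
exact: aa0.
Qed.

Lemma cartan_reflection a x y : a != 0 ->
  cartan form (reflection form a x) (reflection form a y) = cartan form x y.
Proof. by move=> a0; rewrite /cartan !dot_reflection. Qed.

Lemma reflection_conj a b x : a != 0 ->
  reflection form (reflection form a b) x =
  reflection form a (reflection form b (reflection form a x)).
Proof.
move=> a0; rewrite [LHS]reflectionE [reflection form b _]reflectionE.
rewrite [RHS]linearB [X in _ = _ - X]linearZ /= reflectionK //.
by rewrite -[in cartan _ x _](reflectionK form a0 x) cartan_reflection.
Qed.

Lemma reflectionZ (c : R) a : c != 0 ->
  reflection form (c *: a) = reflection form a.
Proof.
move=> c0; apply/lfunP => x; rewrite !reflectionE; congr (_ - _).
rewrite scalerA /cartan linearZl_LR !linearZr_LR /=; congr (_ *: _).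
(* The vector [a] may vanish; both quotients are then divisions by 0, which give 0. *)
have [->|aa0] := eqVneq (form a a) 0; first by rewrite !mulr0 !invr0 !mulr0 mul0r.
by field; rewrite c0 aa0.
Qed.

End Reflections.

(** * Generation by the simple reflections, and cohomologous sections *)

Section SimpleRoots.

Variables (R : realType) (V : vectType R) (form : {dot V for idfun}).
Variables (Phi : root_system form) (n : nat) (alpha : 'I_n -> root Phi).
Hypothesis alpha_simple : simple_roots alpha.

(** The coefficients are real because reflecting a root changes one of them by a value of [cartan],
    which lies in [R]. *)
Lemma simple_roots_inj (x y : 'I_n -> R) :
  \sum_i x i *: val (alpha i) = \sum_i y i *: val (alpha i) -> x =1 y.
Proof.
move=> exy i; apply/eqP; rewrite -subr_eq0; apply/eqP; move: i.
have := basis_free alpha_simple.1.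
have -> : [seq val (alpha i) | i <- enum 'I_n] =
          tval [tuple val (alpha i) | i < n] by [].
move/freeP; apply.
under eq_bigr => i _ do rewrite nth_mktuple scalerBl.
by rewrite sumrB exy subrr.
Qed.

(* The induction is on the height: a positive root b pairs positively with some
   simple root alpha i, and s_i either lowers its height or makes it negative,
   in which case b is a multiple of alpha i. *)
Lemma weyl_simple_ind (P : weyl Phi -> Prop) :
  P 1%g -> (forall g h, P g -> P h -> P (g * h)%g) ->
  (forall i, P (weyl_refl (alpha i))) -> forall w, P w.
Proof.
move=> P1 PM Ps.
have Peq (r t : root Phi) (c : R) : c != 0 -> val r = c *: val t ->
    P (weyl_refl t) -> P (weyl_refl r).
  move=> c0 rt Pt; suff -> : weyl_refl r = weyl_refl t by [].
  by apply: val_inj; rewrite /= rt reflectionZ.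
have Ppos (m : nat) (r : root Phi) (c : 'I_n -> nat) : (\sum_i c i <= m)%N ->
    val r = \sum_i val (alpha i) *+ c i -> P (weyl_refl r).
  elim: m r c => [|m IH] r c cm rE.
    case/eqP: (root_neq0 r); rewrite rE big1 // => i _.
    move: cm; rewrite leqn0 sum_nat_eq0 => /forallP/(_ i)/= /eqP ->.
    by rewrite mulr0n.
  (* Otherwise [form (val r) (val r)], expanded along the simple roots with coefficients [c i],
     would be at most 0. *)
  have [i ip] : exists i, 0 < form (val r) (val (alpha i)).
    have rr0 : 0 < form (val r) (val r) by rewrite neq0_dnorm_gt0 ?root_neq0.
    apply/existsP; move: rr0; apply: contraTT.
    rewrite negb_exists => /forallP H; rewrite -leNgt [X in form _ X]rE linear_sumr.
    apply: sumr_le0 => i _; rewrite linearMnr mulrn_wle0 //.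
    by rewrite leNgt H.
  have a0 := root_neq0 (alpha i).
  set a := val (alpha i) in ip a0.
  have tP : reflection form a (val r) \in roots Phi.
    by apply: roots_refl; apply: ssvalP.
  pose t : root Phi := SeqSub tP.
  have pgt0 : 0 < cartan form (val r) a.
    by rewrite divr_gt0 ?neq0_dnorm_gt0 ?mulr_gt0.
  have tE : val t = \sum_j ((c j)%:R - cartan form (val r) a *+ (j == i)) *:
                   val (alpha j).
    rewrite /= reflectionE {1}rE.
    under [RHS]eq_bigr => j _ do rewrite scalerBl scaler_nat.
    rewrite sumrB; congr (_ - _); rewrite (bigD1 i) //= eqxx mulr1n.
    by rewrite big1 ?addr0 // => j /negPf ->; rewrite mulr0n scale0r.
  have Pt : P (weyl_refl t) -> P (weyl_refl r).
    move=> Pt; suff -> : weyl_refl r =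
        (weyl_refl (alpha i) * (weyl_refl t * weyl_refl (alpha i)))%g.
      exact: PM (Ps i) (PM _ _ Pt (Ps i)).
    apply: val_inj; apply/lfunP => x /=; rewrite !comp_lfunE /=.
    by rewrite reflection_conj // !reflectionK.
  have [c' [t'E|t'E]] := alpha_simple.2 t.
    apply: Pt; apply: (IH t c') => //; rewrite -ltnS; apply: leq_trans cm.
    rewrite -(ltr_nat R) !natr_sum.
    have cc' j : (c' j)%:R = (c j)%:R - cartan form (val r) a *+ (j == i).
      move: j; apply: simple_roots_inj.
      by rewrite -tE t'E; apply: eq_bigr => j _; rewrite scaler_nat.
    rewrite (bigD1 i) //= [X in _ < X](bigD1 i) //= cc' eqxx mulr1n.
    rewrite (eq_bigr (fun j => (c j)%:R)); last first.
      by move=> j /negPf ji; rewrite cc' ji subr0.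
    by rewrite ltrD2r gtrBl.
  have cc' j : - (c' j)%:R = (c j)%:R - cartan form (val r) a *+ (j == i).
    move: j; apply: simple_roots_inj.
    rewrite -tE t'E -sumrN; apply: eq_bigr => j _.
    by rewrite scaleNr scaler_nat.
  (* The reflection changes only the coefficient at [i], so for [j != i] the natural number [c j]
     equals [- c' j]. *)
  have c0 j : j != i -> c j = 0%N.
    move=> /negPf ji; apply/eqP; rewrite -(pnatr_eq0 R) eq_le ler0n andbT.
    by have := cc' j; rewrite ji subr0 => <-; rewrite oppr_le0 ler0n.
  have rci : val r = (c i)%:R *: a.
    rewrite rE (bigD1 i) //= big1 ?addr0 ?scaler_nat // => j /c0 ->.
    by rewrite mulr0n.
  apply: (Peq r (alpha i) _ _ rci (Ps i)).
  by apply: contraNneq (root_neq0 r) => ci0; rewrite rci ci0 scale0r.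
have Proot (r : root Phi) : P (weyl_refl r).
  have [c [rE|rE]] := alpha_simple.2 r; first exact: (Ppos _ r c (leqnn _)).
  (* A negative root is replaced by its opposite, its own mirror image, which has the same
     reflection. *)
  have tP : reflection form (val r) (val r) \in roots Phi.
    by apply: roots_refl; apply: ssvalP.
  have tE : val (SeqSub tP : root Phi) = - val r.
    rewrite /= reflectionE cartanaa ?root_neq0 // scaler_nat mulr2n.
    by rewrite opprD addrA subrr sub0r.
  apply: (Peq r (SeqSub tP) (-1)); first by rewrite oppr_eq0 oner_eq0.
    by rewrite tE scaleN1r opprK.
  by apply: (Ppos _ _ c (leqnn _)); rewrite tE rE opprK.
move=> w; case/asboolP: (weyl_funP w) => l; elim: l w => [|r l IH] w wE.
  by have -> : w = 1%g by apply: val_inj.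
have lP : refl_prod l \in in_weyl Phi by apply/asboolP; exists l.
have -> : w = (weyl_refl r * Weyl lP)%g by apply: val_inj.
exact: PM (Proot r) (IH _ _).
Qed.

Lemma root_latticeP (z : root_lattice Phi) :
  exists c : 'I_n -> int, lattice_val z = \sum_i val (alpha i) *~ c i.
Proof.
case/asboolP: (lattice_valP z) => c ->.
elim/big_ind: _ => [||r _].
- by exists (fun=> 0); rewrite big1.
- move=> x y [cx ->] [cy ->]; exists (fun i => cx i + cy i).
  by rewrite -big_split; apply: eq_bigr => i _; rewrite mulrzDr.
have [e [->|->]] := alpha_simple.2 r.
  exists (fun i => (e i)%:Z * c r); rewrite mulrz_suml.
  by apply: eq_bigr => i _; rewrite mulrzA.
exists (fun i => - (e i)%:Z * c r); rewrite -sumrN mulrz_suml.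
by apply: eq_bigr => i _; rewrite mulrzA mulrNz.
Qed.

(** Conjugation by the translation by z adds z - s_i z = <z, alpha_i^vee> alpha_i to the translation
    part at s_i, so one compares coefficients of alpha_i. Both sides are multiplicative in g, so
    agreement on the simple reflections suffices. *)
Lemma cohomologousP (s1 s2 : section Phi) (a b : 'I_n -> int) :
  (forall i, s1 (weyl_refl (alpha i)) =
     (translation (lattice_root (alpha i) *~ a i)
        * sd_weyl (weyl_refl (alpha i)))%g) ->
  (forall i, s2 (weyl_refl (alpha i)) =
     (translation (lattice_root (alpha i) *~ b i)
        * sd_weyl (weyl_refl (alpha i)))%g) ->
  cohomologous s1 s2 <->
  exists z : 'I_n -> int, forall i,
    \sum_j (z j)%:~R * cartan form (val (alpha j)) (val (alpha i))
    = (b i - a i)%:~R.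
Proof.
move=> s1E s2E.
have key (z : root_lattice Phi) i : (s2 (weyl_refl (alpha i)) =
    (translation z * s1 (weyl_refl (alpha i)) * translation (- z))%g) <->
    cartan form (lattice_val z) (val (alpha i)) = (b i - a i)%:~R.
  have valMz (x : root_lattice Phi) (m : int) :
      lattice_val (x *~ m) = lattice_val x *~ m by apply: (raddfMz val).
  have valN (x : root_lattice Phi) :
      lattice_val (- x) = - lattice_val x by apply: (raddfN val).
  have a0 := root_neq0 (alpha i).
  have E : lattice_val (translation z * s1 (weyl_refl (alpha i)) *
      translation (- z))%g.1 = val (alpha i) *~ a i +
      cartan form (lattice_val z) (val (alpha i)) *: val (alpha i).
    rewrite s1E /= linear0 addr0 id_lfunE valMz !comp_lfun1l linearN /=.
    rewrite reflectionE opprB [_ + _ *~ _]addrC -addrA; congr (_ + _).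
    by rewrite addrC subrK.
  split.
    move=> /(congr1 (fun p => lattice_val p.1)).
    rewrite E s2E /= linear0 addr0 valMz => /eqP; rewrite -!scaler_int addrC.
    rewrite -subr_eq -scalerBl -subr_eq0 -scalerBl scaler_eq0 (negPf a0) orbF.
    by rewrite subr_eq0 intrB => /eqP.
  move=> ci; apply: injective_projections; last first.
    by rewrite s1E s2E /= !mul1g mulg1.
  apply: val_inj; rewrite [RHS]E ci s2E /= linear0 addr0 valMz /=.
  by rewrite -!scaler_int -scalerDl -intrD addrC subrK.
split.
  case/asboolP => z E; have [c zE] := root_latticeP z.
  exists c => i; have /key <- := E (weyl_refl (alpha i)).
  rewrite zE cartan_suml; apply: eq_bigr => j _.
  by rewrite -scaler_int cartanZl.
case=> c cE.
pose z : root_lattice Phi := \sum_j lattice_root (alpha j) *~ c j.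
have zE : lattice_val z = \sum_j val (alpha j) *~ c j.
  rewrite -[LHS]/(val z) raddf_sum.
  by apply: eq_bigr => j _; rewrite (raddfMz val).
apply/asboolP; exists z; apply: weyl_simple_ind.
- have sec1 (s : section Phi) : s 1%g = 1%g.
    by apply: (mulgI (s 1%g)); rewrite -gmulfM !mulg1.
  by rewrite !sec1 mulg1 -translationD subrr.
- move=> g h; rewrite !gmulfM => -> ->; rewrite -!mulgA; do 2!congr (_ * _)%g.
  by rewrite [LHS]mulgA -translationD addNr mul1g.
- move=> i; apply/key; rewrite -cE zE cartan_suml; apply: eq_bigr => j _.
  by rewrite -scaler_int cartanZl.
Qed.

End SimpleRoots.

(** * Divisibility and the linear system of type A *)

(** The integer is replaced by its residue, a natural number below [m]. For [m] at most 1 the type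
    ['Z_m] has two elements, whence the bound. *)
Lemma intr_Zp_eq0 (m : nat) (x : int) : (1 < m)%N ->
  (x%:~R == 0 :> 'Z_m) = (m %| x)%Z.
Proof.
move=> m1; have -> : x%:~R = `|(x %% m)%Z|%:R :> 'Z_m.
  rewrite {1}(divz_eq x m) intrD intrM [m%:~R](_ : _ = 0) ?mulr0 ?add0r.
    by rewrite pmulrn gez0_abs // modz_ge0 //; lia.
  by apply: val_inj; rewrite -[m%:~R]/(m%:R) /= val_Zp_nat // modnn.
rewrite -val_eqE /= val_Zp_nat //.
have xm : (`|(x %% m)%Z| < m)%N by have := ltz_mod x (d := m); lia.
by rewrite modn_small // absz_eq0; apply/eqP/dvdz_mod0P.
Qed.

(** Integral copy of the matrix in [type_A], whose entries lie in [R]. *)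
Definition cartanA {n} (i j : 'I_n) : int :=
  if i == j then 2
  else if (i.+1 == j :> nat) || (j.+1 == i :> nat) then -1 else 0.

(** Here [u] is [z] numbered from 1 and extended by 0 at both ends, which makes the formula uniform
    at the end nodes of the diagram. *)
Lemma sum_cartanA n (z : 'I_n -> int) (i : 'I_n) (u : nat -> int) :
  u 0%N = 0 -> u n.+1 = 0 -> (forall j : 'I_n, u j.+1 = z j) ->
  \sum_j z j * cartanA j i = 2 * u i.+1 - u i - u i.+2.
Proof.
move=> u0 un uz.
have pick k : (k <= n.+1)%N -> u k = \sum_j z j * (j.+1 == k :> nat)%:R.
  case: k => [_|k]; first by rewrite u0 big1 // => j _; rewrite mulr0.
  rewrite ltnS leq_eqVlt => /predU1P[->|kn].
    rewrite un big1 // => j _; rewrite eqSS ltn_eqF ?mulr0 //.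
  rewrite (bigD1 (Ordinal kn)) //= eqxx mulr1 -uz big1 ?addr0 // => j jk.
  by rewrite eqSS -(inj_eq val_inj) /= in jk *; rewrite (negPf jk) mulr0.
have li := ltn_ord i.
rewrite !pick; [|by lia..].
rewrite mulr_sumr -!sumrB; apply: eq_bigr => j _.
rewrite /cartanA -(inj_eq val_inj) /= !eqSS (eq_sym (nat_of_ord j) i.+1).
case: (ltngtP i j) => [ij|ij|ij].
- have -> : (j.+1 == i :> nat) = false by lia.
  by case: eqP => _ /=; ring.
- have -> : (i.+1 == j :> nat) = false by lia.
  by case: eqP => _ /=; ring.
have -> : (j.+1 == i :> nat) = false by lia.
have -> : (i.+1 == j :> nat) = false by lia.
by rewrite /=; ring.
Qed.

(** Summation by parts: the weights are linear, so only boundary terms remain. *)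
Lemma sum_second_difference (u : nat -> int) m : u 0%N = 0 ->
  \sum_(i < m) i.+1%:R * (2 * u i.+1 - u i - u i.+2) =
  m.+1%:R * u m - m%:R * u m.+1.
Proof.
move=> u0; elim: m => [|m IH]; first by rewrite big_ord0 u0; ring.
by rewrite big_ord_recr /= IH; ring.
Qed.

Lemma cartanA_solvable n (d : 'I_n -> int) :
  (exists z : 'I_n -> int, forall i, \sum_j z j * cartanA j i = - d i) <->
  (n.+1 %| \sum_(i < n) i.+1%:R * d i)%Z.
Proof.
split=> [[z zE]|/dvdzP[q qE]].
  pose u k := if k is k'.+1 then oapp z 0 (insub k') else 0.
  have un : u n.+1 = 0 by rewrite /u insubF ?ltnn.
  have uz j : u (nat_of_ord j).+1 = z j by rewrite /u valK.
  have := sum_second_difference u n erefl; rewrite un mulr0 subr0.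
  under eq_bigr => i _ do rewrite -(sum_cartanA _ _ i _ erefl un uz) // zE mulrN.
  rewrite sumrN => /(canRL (@opprK _)) ->.
  by rewrite dvdzE abszN abszM natz dvdn_mulr.
pose D k := oapp d 0 (insub k).
have Dd (i : 'I_n) : D i = d i by rewrite /D valK.
(* A particular solution with [v 0 = 0], obtained by summing [D] twice; its value at [n.+1] is not
   yet 0. *)
pose v k := \sum_(m < k) \sum_(i < m) D i.
have vE k : 2 * v k.+1 - v k - v k.+2 = - D k.
  by rewrite /v !big_ord_recr /=; ring.
have v0 : v 0%N = 0 by rewrite /v big_ord0.
(* The weighted sum gives (n+1) v_n - n v_{n+1} = - q (n+1), which exhibits v_{n+1} as a multiple of
   n+1. *)
have vn : v n.+1 = n.+1%:R * (v n.+1 - v n - q).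
  have := sum_second_difference v n v0.
  under eq_bigr => i _ do rewrite vE Dd mulrN.
  rewrite sumrN qE natz => /eqP; lia.
pose t := v n.+1 - v n - q.
(* A linear term has zero second difference and vanishes at 0; the slope [t] is chosen to cancel
   [v n.+1]. *)
pose u k := v k - k%:R * t.
have u0 : u 0%N = 0 by rewrite /u v0; ring.
have un : u n.+1 = 0 by rewrite /u vn -/t subrr.
exists (fun j => u j.+1) => i.
by rewrite (sum_cartanA _ _ i _ u0 un) // -Dd -vE /u; ring.
Qed.

Theorem proposition3p2 (R : realType) (V : vectType R)
    (form : {dot V for idfun}) (Phi : root_system form)
    (n : nat) (n_gt0 : (0 < n)%N) (alpha : 'I_n -> root Phi)
    (alpha_simple : simple_roots alpha) (alpha_A : type_A alpha)
    (s1 s2 : section Phi) (a b d : 'I_n -> int)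
    (s1E : forall i, s1 (weyl_refl (alpha i)) =
      (translation (lattice_root (alpha i) *~ a i)
         * sd_weyl (weyl_refl (alpha i)))%g)
    (s2E : forall i, s2 (weyl_refl (alpha i)) =
      (translation (lattice_root (alpha i) *~ b i)
         * sd_weyl (weyl_refl (alpha i)))%g)
    (dE : forall i, d i = a i - b i) :
  H1_class s1 <> H1_class s2 <->
  \sum_(i < n) i.+1%:R * (d i)%:~R != 0 :> 'Z_n.+1.
Proof.
have ZE : \sum_(i < n) i.+1%:R * (d i)%:~R =
    (\sum_(i < n) i.+1%:R * d i)%:~R :> 'Z_n.+1.
  by rewrite rmorph_sum; apply: eq_bigr => i _; rewrite /= intrM natz -pmulrn.
rewrite ZE intr_Zp_eq0 //; apply: (iff_trans _ (rwP negP)).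
have H1E : H1_class s1 = H1_class s2 <-> cohomologous s1 s2.
  by split=> /(@eqquotP _ _ (H1 Phi)).
rewrite H1E (cohomologousP _ _ _ _ _ _ alpha_simple _ _ _ _ s1E s2E) -cartanA_solvable.
(* The system over [R] is the image of the integral one under the injection of [int], with
   right-hand side [b i - a i = - d i]. *)
suff E (z : 'I_n -> int) i :
    \sum_j (z j)%:~R * cartan form (val (alpha j)) (val (alpha i)) =
    (\sum_j z j * cartanA j i)%:~R.
  by split=> H [z zE]; apply: H; exists z => i; move: (zE i);
    rewrite E dE opprB; [move->|move/intr_inj].
rewrite rmorph_sum; apply: eq_bigr => j _.
rewrite /= intrM alpha_A /cartanA; congr (_ * _).
by do 2?case: ifP.
Qed.
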